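(* Let $S$ be a subsemigroup of the bicyclic semigroup $\mathscr{C}(p,q)$. If $S$ contains infinitely many idempotents, then every shift-continuous Hausdorff topology on $S$ is discrete.
   Context: $\omega$ denotes the set of non-negative integers. The bicyclic monoid (bicyclic semigroup) $\mathscr{C}(p,q)$ is the semigroup with identity $1$ generated by two elements $p$ and $q$ subject only to the condition $pq=1$. Its elements are written uniquely as $q^kp^l$ with $k,l\in\omega$, and the operation is $$q^kp^l\cdot q^mp^n=\begin{cases} q^{k-l+m}p^n, & l<m;\\ q^kp^n, & l=m;\\ q^kp^{l-m+n}, & l>m.\end{cases}$$ A topology $\tau$ on a semigroup $S$ is called shift-continuous if $(S,\tau)$ is a semitopological semigroup, i.e. the multiplication $S\times S\to S$ is separately continuous: for every $s\in S$ both maps $S\to S$, $x\mapsto sx$ and $x\mapsto xs$ are continuous. *)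

(* Defs.v *)
From HB Require Import structures.
From mathcomp Require Import all_boot zify.
From mathcomp Require Import all_classical topology.

Set Implicit Arguments.
Unset Strict Implicit.
Unset Printing Implicit Defensive.

Local Open Scope group_scope.
Local Open Scope classical_set_scope.

(* [Bicyclic k l] is the element q^k p^l in normal form. *)
Variant bicyclic : Set := Bicyclic of nat & nat.

Definition nat_pair_of_bicyclic (x : bicyclic) : nat * nat :=
  let: Bicyclic k l := x in (k, l).
Definition bicyclic_of_nat_pair (u : nat * nat) : bicyclic :=
  Bicyclic u.1 u.2.
Lemma nat_pair_of_bicyclicK : cancel nat_pair_of_bicyclic bicyclic_of_nat_pair.
Proof. by case. Qed.
HB.instance Definition _ :=
  Countable.copy bicyclic (can_type nat_pair_of_bicyclicK).

(* The exponents k - l + m and l - m + n are written with the subtraction last,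
   because subtraction on nat is truncated. *)
Definition bicyclic_mul (x y : bicyclic) : bicyclic :=
  let: Bicyclic k l := x in
  let: Bicyclic m n := y in
  if (l < m)%N then Bicyclic (k + m - l)%N n
  else if l == m then Bicyclic k n
  else Bicyclic k (l + n - m)%N.

Definition bicyclic_one : bicyclic := Bicyclic 0 0.

Lemma bicyclic_mulE k l m n :
  bicyclic_mul (Bicyclic k l) (Bicyclic m n) =
  Bicyclic (k + (m - l))%N (n + (l - m))%N.
Proof.
rewrite /bicyclic_mul; case: ltnP => [|lem]; last case: eqP => [->|nlm].
all: by move=> *; congr Bicyclic; lia.
Qed.

Lemma bicyclic_mulA : associative bicyclic_mul.
Proof.
by move=> [k l] [m n] [r s]; rewrite !bicyclic_mulE; congr Bicyclic; lia.
Qed.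

Lemma bicyclic_mul1 : left_id bicyclic_one bicyclic_mul.
Proof. by move=> [k l]; rewrite bicyclic_mulE; congr Bicyclic; lia. Qed.

Lemma bicyclic_mulr1 : right_id bicyclic_one bicyclic_mul.
Proof. by move=> [k l]; rewrite bicyclic_mulE; congr Bicyclic; lia. Qed.

HB.instance Definition _ := isMonoid.Build bicyclic
  bicyclic_mulA bicyclic_mul1 bicyclic_mulr1.

(* The next lemmas establish the presentation <p, q | p q = 1>: p and q satisfy
   the relation and generate, and any pair satisfying it in a monoid is the
   image of (p, q) under a morphism. *)
Definition bicyclic_p : bicyclic := Bicyclic 0 1.
Definition bicyclic_q : bicyclic := Bicyclic 1 0.

Lemma bicyclic_pq : bicyclic_p * bicyclic_q = 1.
Proof. by []. Qed.

Lemma bicyclicE k l : Bicyclic k l = bicyclic_q ^+ k * bicyclic_p ^+ l.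
Proof.
have qE : bicyclic_q ^+ k = Bicyclic k 0.
  elim: k => // k IHk; rewrite expgS IHk.
  by rewrite [LHS]bicyclic_mulE; congr Bicyclic; lia.
have pE : bicyclic_p ^+ l = Bicyclic 0 l.
  elim: l => // l IHl; rewrite expgS IHl.
  by rewrite [LHS]bicyclic_mulE; congr Bicyclic; lia.
by rewrite qE pE [RHS]bicyclic_mulE; congr Bicyclic; lia.
Qed.

Lemma bicyclic_universal (M : monoidType) (a b : M) : a * b = 1 ->
  exists f : bicyclic -> M,
    [/\ monoid_morphism f, f bicyclic_p = a & f bicyclic_q = b].
Proof.
move=> ab1.
have abX n : a ^+ n * b ^+ n = 1.
  elim: n => [|n IHn]; first by rewrite mulg1.
  by rewrite expgSr expgS -mulgA (mulgA a) ab1 mul1g.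
exists (fun x => let: Bicyclic k l := x in b ^+ k * a ^+ l).
split; rewrite /= ?mul1g ?mulg1//.
split=> [|[k l] [m n]]; first exact: mul1g.
rewrite [_ * Bicyclic _ _]bicyclic_mulE -mulgA [a ^+ l * _]mulgA.
case: (leqP l m) => lm.
- have -> : (l - m = 0)%N by lia.
  rewrite addn0 -[in RHS](subnKC lm) !expgnDr (mulgA (a ^+ l)) abX mul1g.
  by rewrite !mulgA.
- have -> : (m - l = 0)%N by lia.
  rewrite addn0 -[in RHS](subnK (ltnW lm)) [in RHS]expgnDr -(mulgA _ (a ^+ m)) abX.
  by rewrite mulg1 -expgnDr addnC.
Qed.

Definition idempotents (T : magmaType) : set T := [set e : T | e * e = e].
Arguments idempotents : clear implicits.

(* A topology on T is an element [tau] of the class [Topological T], and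
   [Topological.Pack tau] is the corresponding space.  The choice structure
   bundled in [tau] need not be that of T; it plays no role in the topological
   notions below. *)
Definition shift_continuous (T : semigroupType) (tau : Topological T) : Prop :=
  let X := Topological.Pack tau in
  forall s : T,
    continuous ((fun x : T => s * x) : X -> X) /\
    continuous ((fun x : T => x * s) : X -> X).

Definition discrete (X : topologicalType) : Prop := forall A : set X, open A.

Lemma discreteE (X : topologicalType) :
  discrete X <-> @nbhs X X = principal_filter.
Proof.
split=> [dX|nE A]; last first.
  by rewrite openE => x Ax; rewrite /interior nE; apply/principal_filterP.
apply/funext => x; apply/seteqP; split=> A.
  by move=> /nbhs_singleton ?; apply/principal_filterP.
by move=> /principal_filterP Ax; apply: open_nbhs_nbhs.
Qed.

(* Main.v *)
(** An idempotent of the bicyclic monoid has the form q^m p^m; left (right)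
    multiplication by it fixes q^k p^l exactly when m <= k (m <= l).  In a
    Hausdorff space the non-fixed points of a continuous self-map form an open
    set, so every idempotent q^m p^m of S makes the finite set of elements
    q^k p^l of S with k, l < m open.  As S has infinitely many idempotents, m
    can be chosen arbitrarily large, so each point has a finite open
    neighbourhood, hence is isolated. *)

Require Import Defs.
From mathcomp Require Import all_boot zify.
From mathcomp Require Import all_classical topology.

Local Open Scope group_scope.
Local Open Scope classical_set_scope.

Lemma open_non_fixed (X : topologicalType) (f : X -> X) :
  hausdorff_space X -> continuous f -> open [set x | f x <> x].
Proof.
rewrite open_hausdorff => hX cf; rewrite openE => x /eqP /hX.
case=> -[A B] /= [/set_mem Afx /set_mem Bx] [oA oB /eqP AB0].
have : nbhs x (f @^-1` A `&` B).
  by apply: filterI; [apply: cf|]; apply: open_nbhs_nbhs.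
apply: filterS => y /= [Afy By] fyy.
by rewrite -[False]/(set0 y) -AB0; split; rewrite // -fyy.
Qed.

Lemma finite_open_nbhs_discrete (X : topologicalType) : accessible_space X ->
  (forall x : X, exists U, [/\ open U, U x & finite_set U]) -> discrete X.
Proof.
move=> /accessible_finite_set_closed fincl finU A.
rewrite openE => x Ax; have [U [oU Ux fU]] := finU x.
have : nbhs x (U `&` ~` (U `\ x)).
  apply: open_nbhs_nbhs; split; last by split=> // -[_ /(_ erefl)].
  by apply: openI => //; apply: closed_openC; apply: fincl; apply: finite_setD.
by apply: filterS => y [Uy /not_andP[/(_ Uy)|/contrapT ->]].
Qed.

Lemma bicyclic_idempotent_diag (e : bicyclic) :
  e * e = e -> exists m, e = Bicyclic m m.
Proof.
(* Comparing exponents makes both truncated differences [k - l] and [l - k] vanish. *)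
case: e => k l; rewrite [_ * _]bicyclic_mulE => -[? ?].
by exists k; congr Bicyclic; lia.
Qed.

Lemma bicyclic_diag_mull m k l :
  Bicyclic m m * Bicyclic k l = Bicyclic k l <-> m <= k.
Proof.
rewrite [_ * _]bicyclic_mulE; split=> [[? ?]|?]; first lia.
by congr Bicyclic; lia.
Qed.

Lemma bicyclic_diag_mulr m k l :
  Bicyclic k l * Bicyclic m m = Bicyclic k l <-> m <= l.
Proof.
rewrite [_ * _]bicyclic_mulE; split=> [[? ?]|?]; first lia.
by congr Bicyclic; lia.
Qed.

Definition bicyclic_box (m : nat) : set bicyclic :=
  [set x | let: Bicyclic k l := x in k < m /\ l < m].

Lemma finite_bicyclic_box m : finite_set (bicyclic_box m).
Proof.
apply: (@sub_finite_set _ _ (bicyclic_of_nat_pair @` (`I_m `*` `I_m))).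
  by case=> k l ?; exists (k, l).
exact/finite_image/finite_setX.
Qed.

Lemma bicyclic_box_unfixed m (x : bicyclic) :
  bicyclic_box m x <->
  Bicyclic m m * x <> x /\ x * Bicyclic m m <> x.
Proof.
case: x => k l; rewrite bicyclic_diag_mull bicyclic_diag_mulr /=.
by split=> -[/negP ? /negP ?]; split; lia.
Qed.

Lemma finite_preimage_bicyclic_box {P : pred bicyclic} {S : subSemigroupType P} m :
  finite_set ((val : S -> bicyclic) @^-1` bicyclic_box m).
Proof.
apply: finite_preimage; last exact: finite_bicyclic_box.
by move=> x y _ _; apply: val_inj.
Qed.

(** Otherwise all idempotents of [S] would lie in the box of side [n], which meets [S] in a finite
    set. *)
Lemma idempotents_unbounded {P : pred bicyclic} {S : subSemigroupType P} n :
  infinite_set (idempotents S) ->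
  exists (e : S) m, n <= m /\ val e = Bicyclic m m.
Proof.
move=> Sinf; apply: contrapT => noe; apply: Sinf.
apply: sub_finite_set (finite_preimage_bicyclic_box n) => e ee.
have [m em] : exists m, val e = Bicyclic m m.
  by apply: bicyclic_idempotent_diag; rewrite -valM ee.
rewrite /preimage /= em /=.
case: (leqP n m) => // nm; case: noe; by exists e, m.
Qed.

Theorem theorem1 (P : pred bicyclic) (S : subSemigroupType P)
    (S_inf : infinite_set (idempotents S)) (tau : Topological S)
    (tau_shift : shift_continuous tau)
    (tau_hausdorff : hausdorff_space (Topological.Pack tau)) :
  discrete (Topological.Pack tau).
Proof.
apply: finite_open_nbhs_discrete; first exact: hausdorff_accessible.
move=> x; case vx: (val (x : S)) => [k l].
(* The successor makes [m] exceed both [k] and [l], so the box contains [x]. *)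
have [e [m [klm em]]] := idempotents_unbounded (maxn k l).+1 S_inf.
have [ce ce'] := tau_shift e.
pose V : set S := (val : S -> bicyclic) @^-1` bicyclic_box m.
have VE : V = [set y : S | e * y <> y] `&` [set y : S | y * e <> y].
  (* As [val] is multiplicative and injective, being fixed means the same in [S] as in the bicyclic
     monoid. *)
  apply/seteqP; split=> y; rewrite /V /preimage /= bicyclic_box_unfixed -em -!valM.
    by case=> ey ye; split=> [/(congr1 val)|/(congr1 val)].
  by case=> ey ye; split=> /val_inj.
exists V; split.
- rewrite VE; apply: (@openI (Topological.Pack tau));
    exact: (@open_non_fixed (Topological.Pack tau)).
- by rewrite /V /preimage /= vx /=; lia.
- exact: finite_preimage_bicyclic_box.
Qed.
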